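(* Let $\Delta_{\mathrm{opt}}$ denote the infimum of the densities of all lattice-like cylinder coverings of $\mathbf{Sol}$ related to fundamental lattices $\Gamma(t_1^1,t_1^2,N)$, taken over all real $t_1^1,t_1^2\ne0$, all integers $N\ge3$ and all admissible radii $r>0$. Let $\Delta(t_1^1,t_1^2,N)$ denote the smallest density of such a covering for the given lattice $\Gamma(t_1^1,t_1^2,N)$, i.e. the minimum over admissible $r$. Then $$1.20920\approx\frac{2\pi}{\sqrt{27}}\ \le\ \Delta_{\mathrm{opt}}\ \le\ \Delta\Big(1,\,\tfrac{3-\sqrt5}{2},\,3\Big)=-\frac{36}{125}\,\frac{(2\sqrt5-5)^2\,\pi\sqrt5}{(\sqrt5-3)^3}\approx 1.26447 .$$
   Context: $\mathbf{Sol}$ is $\mathbb R^3$ with the group law $(a,b,c)(x,y,z)=(x+ae^{-z},\,y+be^{z},\,z+c)$, and translations act on points by right multiplication. The invariant metric is $ds^2=e^{2z}dx^2+e^{-2z}dy^2+dz^2$, so that volume is the Lebesgue measure $dx\,dy\,dz$. The plane $z=0$ is called the base plane. Fundamental lattice: for real $t_1^1,t_1^2\ne0$ and an integer $N\ge3$, put $h=\log\frac{N+\sqrt{N^2-4}}{2}$. Then $\Gamma(t_1^1,t_1^2,N)$ is the subgroup generated by $\tau_1=(t_1^1,t_1^2,0)$, $\tau_2=(t_1^1e^{-h},t_1^2e^{h},0)$, $\tau_3=(0,0,h)$. Let $\Gamma^0=\{m\tau_1+n\tau_2: m,n\in\mathbb Z\}$ be its sublattice in the base plane. The fundamental parallelepiped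 $\mathcal P$ has base parallelogram $\mathcal P^b$ spanned by $\tau_1,\tau_2$, of area $|t_1^1t_1^2(e^h-e^{-h})|$, and $\mathrm{Vol}(\mathcal P)=h\cdot\mathrm{Area}(\mathcal P^b)$. Cylinders: $\mathcal C^i(r)=\{(x,y,z): x^2+y^2\le r^2\}$ is the infinite circular cylinder of radius $r$. It is bounded by the translation curves in the direction of the $z$-axis (vertical lines) through the points of the circle of radius $r$ about the origin in the base plane. For $\tau=(x^1,x^2,0)$, its translate $\mathcal C^i_\tau(r)$ is the vertical cylinder of radius $r$ over the disk centred at $(x^1,x^2)$. The bounded cylinder $\mathcal C(r,h)$ is the part $0\le z\le h$ of $\mathcal C^i(r)$, with base disk $\mathcal C^b(r)$ and volume $\pi r^2h$. Lattice-like cylinder covering related to $\Gamma(t_1^1,t_1^2,N)$: the family $\{\mathcal C^i_\tau(r):\tau\in\Gamma^0\}$ (cut into bounded cylinders of height $h$), where $r>0$ is admissible. Admissible means that the cylinders cover $\mathbf{Sol}$, equivalently the closed disks of radius $r$ centred at the points of $\Gamma^0$ cover the Euclidean plane. Its density is $$\frac{\mathrm{Vol}(\mathcal C(r,h))}{\mathrm{Vol}(\mathcal P)}=\frac{\mathrm{Area}(\mathcal C^b(r))}{\mathrm{Area}(\mathcal P^b)}=\frac{\pi r^2}{|t_1^1t_1^2(e^h-e^{-h})|}.$$ The symbol $\approx$ means that the decimal value is given to the displayed accuracy. *)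

(* Defs.v *)
From HB Require Import structures.
From mathcomp Require Import all_boot all_order all_algebra.
From mathcomp Require Import ring lra.
From mathcomp Require Import all_classical all_reals all_analysis.
Set Implicit Arguments.
Unset Strict Implicit.
Unset Printing Implicit Defensive.
Import Order.TTheory GRing.Theory Num.Theory.
Import numFieldNormedType.Exports.

Local Open Scope classical_set_scope.
Local Open Scope ring_scope.

(* The point (x, y, z) of Sol is ((x, y), z) : (R * R) * R. *)
Definition sol (R : realType) : Type := (R * R * R)%type.

Section Sol.
Variable R : realType.

HB.instance Definition _ := Choice.on (sol R).

Definition sol_mul (p q : sol R) : sol R :=
  let: (a, b, c) := p in let: (x, y, z) := q in
  (x + a * expR (- z), y + b * expR z, z + c).

Definition sol_one : sol R := (0, 0, 0).

Definition sol_inv (p : sol R) : sol R :=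
  let: (a, b, c) := p in (- (a * expR c), - (b * expR (- c)), - c).

Let sol_mulA : associative sol_mul.
Proof.
move=> [[a b] c] [[x y] z] [[u v] w] /=; rewrite opprD !expRD.
by congr (_, _, _); ring.
Qed.

Let sol_mul1l : left_id sol_one sol_mul.
Proof.
by move=> [[x y] z] /=; congr (_, _, _); rewrite ?mul0r addr0.
Qed.

Let sol_mulr1 : right_id sol_one sol_mul.
Proof.
by move=> [[x y] z] /=; congr (_, _, _); rewrite ?oppr0 ?expR0 ?mulr1 add0r.
Qed.

Let sol_mulVr : left_inverse sol_one sol_inv sol_mul.
Proof.
move=> [[x y] z] /=; congr (_, _, _);
  rewrite ?mulNr -?mulrA -?expRD ?addrN ?addNr ?expR0 ?mulr1 ?addrN //.
Qed.

Let sol_mulrV : right_inverse sol_one sol_inv sol_mul.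
Proof.
move=> [[x y] z] /=; congr (_, _, _); rewrite ?opprK ?addNr //.
Qed.

HB.instance Definition _ := isGroup.Build (sol R)
  sol_mulA sol_mul1l sol_mulr1 sol_mulVr sol_mulrV.

Definition translate (tau : sol R) (A : set (sol R)) : set (sol R) :=
  [set (p * tau)%g | p in A].

Definition is_subgroup (G : set (sol R)) : Prop :=
  [/\ G 1%g, forall p q, G p -> G q -> G (p * q)%g
    & forall p, G p -> G (p^-1)%g].

(* The Riemannian volume of e^(2z) dx^2 + e^(-2z) dy^2 + dz^2, whose
   determinant is 1. *)
Definition Vol (A : set (sol R)) : \bar R :=
  ((lebesgue_measure \x lebesgue_measure) \x lebesgue_measure)%E A.

Section FundamentalLattice.
Variables (t1 t2 : R) (N : int).

Definition lat_h : R := ln ((N%:~R + Num.sqrt (N%:~R ^+ 2 - 4)) / 2).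

Definition tau1 : sol R := (t1, t2, 0).
Definition tau2 : sol R := (t1 * expR (- lat_h), t2 * expR lat_h, 0).
Definition tau3 : sol R := (0, 0, lat_h).

Definition Gamma : set (sol R) :=
  smallest is_subgroup [set tau1; tau2; tau3].

Definition Gamma0 : set (sol R) :=
  [set p | exists m n : int,
     p = (m%:~R * tau1.1.1 + n%:~R * tau2.1.1,
          m%:~R * tau1.1.2 + n%:~R * tau2.1.2, 0)].

Definition parallelepiped : set (sol R) :=
  [set p | exists s u : R, [/\ 0 <= s <= 1, 0 <= u <= 1, 0 <= p.2 <= lat_h
    & p.1 = (s * tau1.1.1 + u * tau2.1.1, s * tau1.1.2 + u * tau2.1.2)]].

End FundamentalLattice.

Definition cylinder (r : R) : set (sol R) :=
  [set p | p.1.1 ^+ 2 + p.1.2 ^+ 2 <= r ^+ 2].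

Definition bounded_cylinder (r h : R) : set (sol R) :=
  [set p | cylinder r p /\ 0 <= p.2 <= h].

Definition admissible (t1 t2 : R) (N : int) (r : R) : Prop :=
  0 < r /\ \bigcup_(tau in Gamma0 t1 t2 N) translate tau (cylinder r) = setT.

(* Both volumes are finite, so [fine] loses nothing. *)
Definition density (t1 t2 : R) (N : int) (r : R) : R :=
  fine (Vol (bounded_cylinder r (lat_h N)))
    / fine (Vol (parallelepiped t1 t2 N)).

Definition densities (t1 t2 : R) (N : int) : set R :=
  [set density t1 t2 N r | r in admissible t1 t2 N].

(* That this infimum is a minimum has to be stated separately, as
   [densities t1 t2 N (Delta t1 t2 N)]. *)
Definition Delta (t1 t2 : R) (N : int) : R := inf (densities t1 t2 N).

Definition all_densities : set R :=
  [set d | exists (t1 t2 : R) (N : int),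
     [/\ t1 != 0, t2 != 0, 3 <= N & densities t1 t2 N d]].

Definition Delta_opt : R := inf all_densities.

End Sol.

Arguments lat_h {R} N.
Arguments tau3 {R} N.
Arguments Delta_opt R : clear implicits.

(* [Gamma0], given by integer combinations, is the part of the group in the
   base plane. *)
Lemma Gamma0E (R : realType) (t1 t2 : R) (N : int) : 3 <= N ->
  Gamma0 t1 t2 N = Gamma t1 t2 N `&` [set p | p.2 = 0].
Proof.
move=> N3; pose h : R := lat_h N.
have N3' : 3 <= N%:~R :> R by rewrite (_ : 3 = 3%:~R)// ler_int.
pose s : R := Num.sqrt (N%:~R ^+ 2 - 4).
have s0 : 0 <= s by exact: sqrtr_ge0.
have s2 : s ^+ 2 = N%:~R ^+ 2 - 4 by rewrite sqr_sqrtr//; nra.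
pose l : R := (N%:~R + s) / 2.
have l1 : 1 < l by rewrite /l; lra.
have lN : l * (N%:~R - l) = 1.
  have -> : l * (N%:~R - l) = (N%:~R ^+ 2 - s ^+ 2) / 4 by rewrite /l; field.
  by rewrite s2; field.
have l0 : l != 0 by rewrite gt_eqF//; lra.
have El : expR h = l by rewrite /h /lat_h lnK// posrE -/s -/l; lra.
have EVl : expR (- h) = N%:~R - l.
  by rewrite expRN El; apply: (mulfI l0); rewrite lN divff.
have h0 : h != 0.
  by apply/eqP => hE; move: El l1; rewrite hE expR0 => <-; rewrite ltxx.
move: l l1 lN l0 El EVl => {s s0 s2} l l1 lN l0 El EVl.
pose lat (v : R * R) := exists m n : int,
  v = (t1 * (m%:~R + n%:~R * (N%:~R - l)), t2 * (m%:~R + n%:~R * l)).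
have latE p : Gamma0 t1 t2 N p <-> lat p.1 /\ p.2 = 0.
  rewrite /Gamma0 /lat /= -/h El EVl; case: p => -[x y] z /=; split.
    move=> [m [n [-> -> ->]]]; split=> //; exists m, n.
    by congr (_, _); ring.
  move=> [[m [n [-> ->]]] ->]; exists m, n.
  by congr (_, _, _); ring.
have latD x y x' y' : lat (x, y) -> lat (x', y') -> lat (x' + x, y' + y).
  move=> [m [n [-> ->]]] [m' [n' [-> ->]]]; exists (m' + m), (n' + n).
  by rewrite !intrD; congr (_, _); ring.
have latN x y : lat (x, y) -> lat (- x, - y).
  move=> [m [n [-> ->]]]; exists (- m), (- n).
  by rewrite !intrN; congr (_, _); ring.
have latp x y : lat (x, y) -> lat (x * (N%:~R - l), y * l).
  move=> [m [n [-> ->]]]; exists (- n), (m + N * n).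
  rewrite intrD intrN intrM; congr (_, _); apply/eqP; rewrite -subr_eq0.
    rewrite [X in X == 0](_ : _ = t1 * n%:~R * (1 - l * (N%:~R - l))); last by ring.
    by rewrite lN subrr mulr0.
  rewrite [X in X == 0](_ : _ = t2 * n%:~R * (1 - l * (N%:~R - l))); last by ring.
  by rewrite lN subrr mulr0.
have latm x y : lat (x, y) -> lat (x * l, y * (N%:~R - l)).
  move=> [m [n [-> ->]]]; exists (n + N * m), (- m).
  rewrite intrD intrN intrM; congr (_, _); apply/eqP; rewrite -subr_eq0.
    rewrite [X in X == 0](_ : _ = t1 * n%:~R * (l * (N%:~R - l) - 1)); last by ring.
    by rewrite lN subrr mulr0.
  rewrite [X in X == 0](_ : _ = t2 * n%:~R * (l * (N%:~R - l) - 1)); last by ring.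
  by rewrite lN subrr mulr0.
have latA (k : int) x y : lat (x, y) ->
    lat (x * expR (- (k%:~R * h)), y * expR (k%:~R * h)).
  elim/int_ind: k x y => [x y|k IH x y|k IH x y] Lxy.
  - by rewrite mul0r oppr0 expR0 !mulr1.
  - rewrite -add1n PoszD intrD mulrDl mul1r opprD !expRD El EVl !mulrA.
    exact/IH/latp.
  - rewrite -add1n PoszD opprD intrD mulrDl mulN1r opprD opprK !expRD El EVl.
    rewrite !mulrA; exact/IH/latm.
pose G := Gamma t1 t2 N.
have GG : is_subgroup G.
  split=> [A [[]]//|p q Gp Gq A|p Gp A] AG; case: (AG) => -[A1 AM AV] _.
    by apply: AM; [exact: Gp|exact: Gq].
  by apply: AV; exact: Gp.
have [G1 GM GV] := GG.
have tG : [set tau1 t1 t2; tau2 t1 t2 N; tau3 N] `<=` G.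
  exact: sub_gen_smallest.
have Gint x y (m : int) : G (x, y, 0) -> G (m%:~R * x, m%:~R * y, 0).
  move=> Gxy; elim/int_ind: m => [|m IH|m IH].
  - by rewrite !mul0r.
  - have := GM _ _ Gxy IH; congr G; rewrite [LHS]/(sol_mul _ _) /=.
    rewrite oppr0 expR0 !mulr1 -add1n PoszD intrD.
    by congr (_, _, _); ring.
  - have := GM _ _ (GV _ Gxy) IH; congr G; rewrite [LHS]/(sol_mul _ _) /=.
    rewrite ?oppr0 expR0 !mulr1 -add1n PoszD opprD intrD.
    by congr (_, _, _); ring.
apply/seteqP; split=> [p|p [Gp p0]].
  move=> [m [n ->]]; split=> //.
  have t1G := Gint _ _ m (tG _ (or_introl (or_introl erefl))).
  have t2G := Gint _ _ n (tG _ (or_introl (or_intror erefl))).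
  have := GM _ _ t2G t1G; congr G.
  by rewrite [LHS]/(sol_mul _ _) /= oppr0 expR0 !mulr1 addr0.
suff [Lp _] : lat p.1 /\ exists k : int, p.2 = k%:~R * h by exact/latE.
have lat00 : lat (0, 0) by exists 0, 0; congr (_, _); ring.
pose T : set (sol R) := [set p | lat p.1 /\ exists k : int, p.2 = k%:~R * h].
apply: (Gp T); split; [split|].
- by split=> //; exists 0; rewrite mul0r.
- move=> [[a b] c] [[x y] z] [/= Lab [k ->]] [/= Lxy [j ->]]; split=> /=.
    exact: latD (latA j _ _ Lab) Lxy.
  by exists (j + k); rewrite intrD mulrDl.
- move=> [[a b] c] [/= Lab [k ->]]; split=> /=.
    by have := latA (- k) _ _ Lab; rewrite intrN mulNr opprK => /latN.
  by exists (- k); rewrite intrN mulNr.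
- move=> _ [[->|->]|->] /=.
  + split; last by exists 0; rewrite mul0r.
    by exists 1, 0; congr (_, _); ring.
  + split; last by exists 0; rewrite mul0r.
    by rewrite /tau2 /= -/h El EVl; exists 0, 1; congr (_, _); ring.
  + by split=> //; exists 1; rewrite mul1r.
Qed.

(* Main.v *)
(* Over the base plane a covering by cylinders is a covering of the Euclidean
   plane by the disks of radius r about Gamma0, and its density is the area of
   the disk over the determinant of the lattice.

   Reduction of binary quadratic forms gives Gamma0 a basis a, b for which the
   triangle 0, a, b is not obtuse.  No lattice point lies inside the
   circumcircle of such a triangle, so r is at least its circumradius, while
   among triangles of given circumradius the equilateral one has the largest
   area; this is the bound 2 pi / sqrt 27.  Conversely, disks of radius equal to
   the circumradius cover the triangle, hence the plane.  For the lattice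
   (1, (3 - sqrt 5) / 2, 3) the generators (1, t), (t, 1) already span a
   non-obtuse triangle, so its smallest density is explicit; it simplifies to
   9 sqrt 5 pi / 50. *)
From HB Require Import structures.
Require Import Defs.
From mathcomp Require Import all_boot all_order all_algebra.
From mathcomp Require Import ring lra zify.
From mathcomp Require Import all_classical all_reals all_analysis.
From mathcomp Require Import measurable_realfun.
Import Order.TTheory GRing.Theory Num.Theory.
Import numFieldNormedType.Exports.
Local Open Scope classical_set_scope.
Local Open Scope ring_scope.

Section SolCylinderCoverings.
Variable R : realType.
Notation mu := (@lebesgue_measure R).

(** * Numerical bounds on pi *)

Lemma ge0_primitive_ge0 (f df : R -> R) (x : R) : (forall y : R, is_derive y (1 : R) f (df y)) ->
  f 0 = 0 -> (forall y, 0 <= y -> 0 <= df y) -> 0 <= x -> 0 <= f x.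
Proof.
move=> fdf f0 df0 x0.
have cf : {within `[0, x], continuous f}.
  apply: continuous_subspaceT => y.
  by apply/differentiable_continuous/derivable1_diffP; apply: ex_derive.
have [c /itvP cx] := MVT_segment x0 (fun z _ => fdf z) cf.
by rewrite f0 !subr0 => ->; rewrite mulr_ge0// df0// cx.
Qed.

Lemma is_derive_expr k (x : R) : is_derive x (1:R) (fun y : R => y ^+ k) (k%:R * x ^+ k.-1).
Proof.
by split; [exact: exprn_derivable|rewrite -derive1E exp_derive1].
Qed.

Lemma is_derive_series_sin_coeff' n (x : R) :
  is_derive x (1:R) (fun y : R => series (sin_coeff' y) n) (series (cos_coeff' x) n).
Proof.
elim: n => [|n IH].
  rewrite /series/= big_geq//; under eq_fun do rewrite big_geq//.
  exact: is_derive_cst.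
rewrite /series/= big_nat_recr//=; under eq_fun do rewrite big_nat_recr//=.
apply: is_deriveD.
rewrite /sin_coeff' /cos_coeff' factS natrM.
under eq_fun do rewrite mulrAC.
apply: (is_derive_eq (is_deriveZ _ (is_derive_expr _ _))).
rewrite /GRing.scale/=.
field.
by rewrite pnatr_eq0 -lt0n fact_gt0 nat1r pnatr_eq0.
Qed.

(** Differentiation kills the constant term, whence [n.+1] cosine terms against [n] sine terms. *)
Lemma is_derive_series_cos_coeff' n (x : R) :
  is_derive x (1:R) (fun y : R => series (cos_coeff' y) n.+1) (- series (sin_coeff' x) n).
Proof.
elim: n => [|n IH].
  rewrite /series/= big_geq// oppr0; under eq_fun do rewrite big_nat1 /cos_coeff' expr0.
  exact: is_derive_cst.
rewrite /series/= [in X in is_derive _ _ _ X]big_nat_recr//= opprD.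
under eq_fun do rewrite big_nat_recr//=.
apply: is_deriveD.
rewrite /sin_coeff' /cos_coeff' doubleS factS natrM.
under eq_fun do rewrite mulrAC.
apply: (is_derive_eq (is_deriveZ _ (is_derive_expr _ _))).
rewrite /GRing.scale/= exprSz.
field.
by rewrite pnatr_eq0 -lt0n fact_gt0 -natrD pnatr_eq0.
Qed.

Lemma series_sin_coeff'0 n : series (sin_coeff' (0:R)) n = 0.
Proof. by rewrite /series/= big1// => i _; rewrite /sin_coeff' expr0n/= mulr0 mul0r. Qed.

Lemma series_cos_coeff'0 n : series (cos_coeff' (0:R)) n.+1 = 1.
Proof.
rewrite /series/= big_nat_recl// big1 => [|i _]; last by rewrite /cos_coeff' expr0n/= mulr0 mul0r.
by rewrite /cos_coeff' fact0 expr0z expr0; lra.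
Qed.

(** Taylor remainders alternate in sign on the half-line: start from [cos <= 1] and integrate from
    0. The sine remainder is a primitive of the cosine remainder, and the next cosine remainder is
    one of minus the sine remainder. *)
Lemma sin_cos_alternating n (x : R) : 0 <= x ->
  0 <= (-1) ^+ n.+1 * (cos x - series (cos_coeff' x) n.+1) /\
  0 <= (-1) ^+ n.+1 * (sin x - series (sin_coeff' x) n.+1).
Proof.
have step m : (forall y : R, 0 <= y -> 0 <= (-1) ^+ m * (cos y - series (cos_coeff' y) m)) ->
   forall y : R, 0 <= y -> 0 <= (-1) ^+ m * (sin y - series (sin_coeff' y) m).
  move=> H y y0; pose e : R := (-1) ^+ m.
  have D z : is_derive z (1:R) (fun y => e * (sin y - series (sin_coeff' y) m))
      (e * (cos z - series (cos_coeff' z) m)).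
    exact: (is_deriveZ _ (is_deriveB (is_derive_sin z) (is_derive_series_sin_coeff' m z))).
  by refine (ge0_primitive_ge0 _ _ _ D _ H y0); rewrite sin0 series_sin_coeff'0 subr0 mulr0.
elim: n x => [|n IH] x x0.
  have H0 (y : R) : 0 <= y -> 0 <= (-1) ^+ 1 * (cos y - series (cos_coeff' y) 1).
    move=> _; rewrite expr1 mulN1r opprB subr_ge0 /series/= big_nat1.
    by rewrite /cos_coeff' fact0 expr0 expr0z !mul1r invr1 cos_le1.
  by split; [exact: H0|exact: step].
have H0 (y : R) : 0 <= y -> 0 <= (-1) ^+ n.+2 * (cos y - series (cos_coeff' y) n.+2).
  move=> y0; pose e : R := (-1) ^+ n.+2.
  have D z : is_derive z (1:R) (fun y => e * (cos y - series (cos_coeff' y) n.+2))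
      (e * (- sin z - - series (sin_coeff' z) n.+1)).
    exact: (is_deriveZ _ (is_deriveB (is_derive_cos z) (is_derive_series_cos_coeff' n.+1 z))).
  apply: (ge0_primitive_ge0 _ _ _ D _ _ y0).
    by rewrite cos0 series_cos_coeff'0 subrr mulr0.
  move=> z z0; have [_] := IH z z0; rewrite /e (exprS _ n.+1).
  by move: ((-1) ^+ n.+1) => w; congr (_ <= _); ring.
by split; [exact: H0|exact: step].
Qed.

Lemma sin_coeff'_lt5 (x : R) : [/\ sin_coeff' x 0 = x, sin_coeff' x 1 = - (x ^+ 3 / 6),
  sin_coeff' x 2 = x ^+ 5 / 120, sin_coeff' x 3 = - (x ^+ 7 / (7 * 720))
  & sin_coeff' x 4 = x ^+ 9 / (9 * (8 * (7 * 720)))].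
Proof.
have f6 : 6`! = 720%N by [].
split; rewrite /sin_coeff' ?exprSz ?expr0z.
- by rewrite divr1 mul1r expr1.
- by rewrite -[1.*2.+1]/3%N -[3`!]/6%N !mulr1 mulN1r mulNr.
- by rewrite -[2.*2.+1]/5%N -[5`!]/120%N !mulr1 mulrNN !mul1r.
- rewrite -[3.*2.+1]/7%N (factS 6) f6 natrM; ring.
- rewrite -[4.*2.+1]/9%N (factS 8) (factS 7) (factS 6) f6 !natrM; ring.
Qed.

(** Tripling the angle gives sin (pi / 2) = 1, so s is a root of 4 s^3 - 3 s + 1 = (s + 1) (2 s -
    1)^2, and s > 0 excludes -1. *)
Lemma sin_pi6 : sin (pi / 6) = 1 / 2 :> R.
Proof.
set x := pi / 6; set s := sin x.
have pi0 := pi_gt0 R.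
have x0 : 0 < x by rewrite divr_gt0.
have s0 : 0 < s.
  by apply: sin_gt0_pihalf; rewrite x0/= /x; lra.
have : sin (x + x + x) = 1.
  by rewrite (_ : x + x + x = pi / 2) ?sin_pihalf// /x; field.
rewrite sinD sinD cosD -/s.
have := cos2Dsin2 x; rewrite -/s.
move: (cos x) => c c2 H.
have : (s + 1) * (2 * s - 1) ^+ 2 = 0.
  have -> : (s + 1) * (2 * s - 1) ^+ 2 =
      1 - ((s * c + c * s) * c + (c * c - s * s) * s)
      + 3 * s * (c ^+ 2 + s ^+ 2 - 1) by ring.
  by rewrite H c2; ring.
by move=> /eqP; rewrite mulf_eq0 expf_eq0/= => /orP[|] /eqP; lra.
Qed.

(** If a bound failed, monotonicity of sine would compare sin (pi / 6) = 1/2 with sin a for a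
    rational a. The Taylor sum of degree 9 (from above) or 7 (from below) contradicts this. *)
Lemma pi_bounds : 3 + 14 / 10 ^+ 2 + 159 / 10 ^+ 5 < (pi : R) < 3 + 1416 / 10 ^+ 4.
Proof.
have pi2 := pi_ge2 R.
have mono a b : 0 <= a -> a <= b -> b <= 1 -> sin a <= sin b :> R.
  move=> a0; rewrite le_eqVlt => /predU1P[->//|ab b1]; apply/ltW.
  by rewrite ltr_sin// in_itv/=; apply/andP; split; lra.
apply/andP; split; rewrite ltNge; apply/negP => H.
- pose a : R := (3 + 14 / 10 ^+ 2 + 159 / 10 ^+ 5) / 6.
  have [_ ] := @sin_cos_alternating 4 a ltac:(rewrite /a; lra).
  have := mono (pi / 6) a ltac:(lra) ltac:(rewrite /a; lra) ltac:(rewrite /a; lra).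
  have [c0 c1 c2 c3 c4] := sin_coeff'_lt5 a.
  rewrite sin_pi6 /series/= !big_nat_recr//= big_nil c0 c1 c2 c3 c4 /a; lra.
- pose a : R := (3 + 1416 / 10 ^+ 4) / 6.
  have [_ ] := @sin_cos_alternating 3 a ltac:(rewrite /a; lra).
  have := mono a (pi / 6) ltac:(rewrite /a; lra) ltac:(rewrite /a; lra)
    ltac:(have := pihalf_lt2 R; lra).
  have [c0 c1 c2 c3 c4] := sin_coeff'_lt5 a.
  rewrite sin_pi6 /series/= !big_nat_recr//= big_nil c0 c1 c2 c3 /a; lra.
Qed.

(** * Areas *)

Definition disk (r : R) : set (R * R) := [set p | p.1 ^+ 2 + p.2 ^+ 2 <= r ^+ 2].

Lemma measurable_disk (r : R) : measurable (disk r).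
Proof.
rewrite [disk r](_ : _ = (fun p : R * R => p.1 ^+ 2 + p.2 ^+ 2) @^-1` `]-oo, r ^+ 2]); last first.
  by apply/seteqP; split => p /=; rewrite in_itv.
rewrite -[X in measurable X]setTI.
have H : measurable_fun setT (fun p : R * R => p.1 ^+ 2 + p.2 ^+ 2).
  by apply: measurable_funD; apply: measurable_funX.
exact: H.
Qed.

Lemma xsection_disk (r x : R) : 0 <= r -> xsection (disk r) x =
  if x \in `[- r, r] then `[- Num.sqrt (r ^+ 2 - x ^+ 2), Num.sqrt (r ^+ 2 - x ^+ 2)]%classic
  else set0.
Proof.
move=> r0; apply/seteqP; split=> y; rewrite /xsection/= inE /disk/=.
  move=> h.
  have xr : x ^+ 2 <= r ^+ 2 by have := sqr_ge0 y; lra.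
  have -> : x \in `[- r, r].
    by rewrite in_itv/= -ler_norml -(ler_pXn2r (n:=2))// ?nnegrE// real_normK// num_real.
  rewrite /= in_itv/= -ler_norml -sqrtr_sqr ler_wsqrtr//; lra.
case: ifPn => //; rewrite in_itv/= -ler_norml => xr.
have {}xr : x ^+ 2 <= r ^+ 2 by rewrite -[x ^+ 2]real_normK ?num_real// lerXn2r// nnegrE.
rewrite /= in_itv/= -ler_norml -sqrtr_sqr ler_sqrt; lra.
Qed.

Lemma measurable_two_strips (a1 a2 b1 b2 : R) :
  measurable [set p : R * R | 0 <= a1 * p.1 + b1 * p.2 <= 1 /\ 0 <= a2 * p.1 + b2 * p.2 <= 1].
Proof.
have H (a b : R) : measurable [set p : R * R | 0 <= a * p.1 + b * p.2 <= 1].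
  rewrite [X in measurable X](_ : _ = (fun p : R * R => a * p.1 + b * p.2) @^-1` `[0, 1]); last first.
    by apply/seteqP; split => p /=; rewrite in_itv.
  have H : measurable_fun setT (fun p : R * R => a * p.1 + b * p.2).
    by apply: measurable_funD; apply: measurable_funM.
  by rewrite -[X in measurable X]setTI; exact: H.
exact: (measurableI _ _ (H a1 b1) (H a2 b2)).
Qed.

(** The pushforward of [mu] under the translation agrees with [mu] on half-open intervals, hence
    everywhere by uniqueness. *)
Lemma lebesgue_measure_translation (c : R) (A : set R) : measurable A ->
  mu [set x | A (x + c)] = mu A.
Proof.
move=> mA.
pose g : measurableTypeR R -> measurableTypeR R := fun x => x + c.
have mg : measurable_fun setT g.
  exact: (@measurable_funD _ (measurableTypeR R)).
pose f : {mfun measurableTypeR R >-> measurableTypeR R} :=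
  HB.pack g (isMeasurableFun.Build _ _ _ _ _ mg).
symmetry; apply: (@lebesgue_measure_unique _ (pushforward mu f)) => // X [[a b] _ <-].
rewrite /pushforward/= [X in _ = lebesgue_measure X](_ : _ = `]a - c, b - c]%classic).
  rewrite !lebesgue_measure_itv/= !lte_fin ltrD2r; case: ifPn => // _.
  rewrite -!EFinB; congr (_%:E); ring.
apply/seteqP; split => x/=; rewrite !in_itv/= /g; lra.
Qed.

(** The product [\x] integrates vertical sections and [\x^] horizontal ones; both give rectangles
    the same measure, so uniqueness identifies them. *)
Lemma area_ysection (A : set (R * R)) : measurable A ->
  (mu \x mu)%E A = (\int[mu]_y (mu (ysection A y)))%E.
Proof.
move=> mA.
transitivity ((mu \x^ mu)%E A); last by [].
apply: product_measure_unique => //= X Y mX mY.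
exact: product_measure2E.
Qed.

Lemma lebesgue_measure_affine_unit_itv (a c : R) : a != 0 ->
  mu [set x | 0 <= (x - c) / a <= 1] = `|a|%:E.
Proof.
move=> a0.
case: (ltrgtP a 0) a0 => // a0 _.
- rewrite [X in mu X](_ : _ = `[c + a, c]%classic); last first.
    apply/seteqP; split => x /=; rewrite in_itv/= ler_ndivlMr// ler_ndivrMr//; lra.
  rewrite lebesgue_measure_itv/= lte_fin ltr0_norm// (_ : c + a < c) ?gtrDl//.
  by rewrite -EFinB; congr (_%:E); ring.
- rewrite [X in mu X](_ : _ = `[c, c + a]%classic); last first.
    apply/seteqP; split => x /=; rewrite in_itv/= ler_pdivlMr// ler_pdivrMr//; lra.
  rewrite lebesgue_measure_itv/= lte_fin gtr0_norm// (_ : c < c + a) ?ltrDl//.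
  by rewrite -EFinB; congr (_%:E); ring.
Qed.

(** Each vertical section is merely translated, by an amount depending on x only. *)
Lemma area_shear (k : R) (A : set (R * R)) : measurable A ->
  (mu \x mu)%E [set p | A (p.1, p.2 - k * p.1)] = (mu \x mu)%E A.
Proof.
move=> mA; apply: eq_integral => x _ /=.
rewrite -[RHS](lebesgue_measure_translation (- (k * x))); last exact: measurable_xsection.
by congr (mu _); apply/seteqP; split => y; rewrite /xsection/= !inE.
Qed.

Definition parallelogram (a1 a2 b1 b2 : R) : set (R * R) := [set p | exists s u,
  [/\ 0 <= s <= 1, 0 <= u <= 1 & p = (s * a1 + u * b1, s * a2 + u * b2)]].

(** Cramer's rule expresses s and u linearly in the point, so the parallelogram is an intersection
    of two strips. *)
Lemma measurable_parallelogram (a1 a2 b1 b2 : R) : a1 * b2 - a2 * b1 != 0 ->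
  measurable (parallelogram a1 a2 b1 b2).
Proof.
set d := _ - _ => d0.
rewrite [parallelogram _ _ _ _](_ : _ = [set p |
    0 <= b2 / d * p.1 + - b1 / d * p.2 <= 1 /\ 0 <= - a2 / d * p.1 + a1 / d * p.2 <= 1]).
  exact: measurable_two_strips.
apply/seteqP; split => -[x y] /=.
  move=> [s [u [s01 u01 [-> ->]]]].
  rewrite (_ : _ + _ = s); last by rewrite /d; field.
  by rewrite (_ : _ + _ = u); last by rewrite /d; field.
set s := _ + _; set u := _ + _ => -[s01 u01]; exists s, u; split => //.
by congr (_, _); rewrite /s /u /d; field.
Qed.

(* The shear y - (a2 / a1) x makes the side a horizontal, and the horizontal
   sections are then intervals of length |a1|. *)
Lemma area_parallelogram (a1 a2 b1 b2 : R) : a1 != 0 -> a1 * b2 - a2 * b1 != 0 ->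
  (mu \x mu)%E (parallelogram a1 a2 b1 b2) = `|a1 * b2 - a2 * b1|%:E.
Proof.
set d := _ - _ => a0 d0.
pose A : set (R * R) := [set p |
  0 <= (a1^-1) * p.1 + (- b1 / d) * p.2 <= 1 /\ 0 <= 0 * p.1 + (a1 / d) * p.2 <= 1].
have mA : measurable A by exact: measurable_two_strips.
rewrite [X in (_ \x _)%E X](_ : _ = [set p | A (p.1, p.2 - (a2 / a1) * p.1)]); last first.
  apply/seteqP; split => -[x y] /=.
    move=> [s [u [s01 u01 [-> ->]]]]; rewrite /A/=.
    rewrite (_ : _ + _ = s); last by rewrite /d; field; rewrite a0.
    rewrite (_ : _ + _ = u); last by rewrite /d; field; rewrite a0.
    by [].
  rewrite /A/=; set s := _ + _; set u := _ + _ => -[s01 u01]; exists s, u; split => //.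
  congr (_, _); rewrite /s /u /d; field; rewrite a0//.
rewrite area_shear// area_ysection//.
(* [D] is the range of heights at which the sheared parallelogram has a nonempty horizontal section;
   its length is |d / a1|. *)
pose D := [set y : R | 0 <= (y - 0) / (d / a1) <= 1].
have DE y : (y - 0) / (d / a1) = a1 / d * y by field; rewrite d0.
have mD : measurable D.
  have := measurable_two_strips 0 0 (a1 / d) (a1 / d).
  rewrite (_ : mkset _ = setT `*` D); last first.
    apply/seteqP; split => -[x y]; rewrite /D/= DE mul0r add0r.
      by case.
    by case.
  by move=> /(measurable_xsection (0 : R)); rewrite in_xsectionX// inE.
transitivity (\int[mu]_(y in D) (cst `|a1|%:E) y)%E.
  rewrite [RHS]integral_mkcond; apply: eq_integral => y _; rewrite patchE.
  case: ifPn; rewrite ?notin_setE ?inE /D/= DE => yA.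
    rewrite -(lebesgue_measure_affine_unit_itv _ (y * a1 * b1 / d) a0).
    congr (mu _); apply/seteqP; split => x /=; rewrite /ysection/= inE /A/=.
      have -> : (x - y * a1 * b1 / d) / a1 = a1^-1 * x + - b1 / d * y by field; rewrite d0.
    by case.
    have -> : (x - y * a1 * b1 / d) / a1 = a1^-1 * x + - b1 / d * y by field; rewrite d0.
    by rewrite mul0r add0r.
  rewrite (_ : ysection _ _ = set0) ?measure0//.
  apply/seteqP; split => x //; rewrite /ysection/= inE /A/= mul0r add0r.
  by case.
rewrite integral_cst//; transitivity (`|a1|%:E * `|d / a1|%:E)%E.
  by congr (_ * _)%E; apply: lebesgue_measure_affine_unit_itv; rewrite mulf_neq0 ?invr_neq0.
by rewrite -EFinM -normrM mulrC divfK.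
Qed.

(** The chord length 2 sqrt (r^2 - x^2) is integrated by the substitution x = r sin u, with
    primitive r^2 (u + sin u cos u). *)
Lemma area_disk (r : R) : 0 < r -> (mu \x mu)%E (disk r) = (pi * r ^+ 2)%:E.
Proof.
move=> r0; have pi0 := pi_gt0 R.
pose F : R -> R := fun x => r * sin x.
pose G : R -> R := fun x => 2 * Num.sqrt (r ^+ 2 - x ^+ 2).
have dF (x : R) : is_derive x (1 : R) F (r * cos x).
  exact: (is_deriveZ _ (is_derive_sin x)).
have F'E : F^`()%classic = fun x => r * cos x.
  by apply/funext => x; rewrite derive1E; apply: derive_val.
have cF : continuous F.
  by move=> x; apply/differentiable_continuous/derivable1_diffP; apply: ex_derive.
have cF' : continuous (fun x : R => r * cos x).
  by move=> x; apply: cvgM; [exact: cvg_cst|exact: continuous_cos].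
have cG : continuous G.
  move=> x; apply: cvgM; first exact: cvg_cst.
  apply: (@cvg_comp _ _ _ (fun x : R => r ^+ 2 - x ^+ 2) Num.sqrt); last exact: sqrt_continuous.
  by apply: cvgB; [exact: cvg_cst|exact: exprn_continuous].
have Fa : F (- (pi / 2)) = - r by rewrite /F sinN sin_pihalf mulrN1.
have Fb : F (pi / 2) = r by rewrite /F sin_pihalf mulr1.
have LR (H : R -> R) a b : continuous H ->
    (forall x : R, derivable H x 1) -> derivable_oo_LRcontinuous H a b.
  move=> cH dH; split; first by move=> x _; exact: dH.
    by apply: cvg_at_right_filter; exact: cH.
  by apply: cvg_at_left_filter; exact: cH.
have GFE (x : R) : - (pi / 2) <= x <= pi / 2 ->
    G (F x) * (r * cos x) = 2 * r ^+ 2 * cos x ^+ 2.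
  move=> xpi; rewrite /G /F.
  have -> : r ^+ 2 - (r * sin x) ^+ 2 = (r * cos x) ^+ 2.
    by rewrite !exprMn cos2sin2; ring.
  rewrite sqrtr_sqr ger0_norm; first by ring.
  by rewrite mulr_ge0 ?(ltW r0)// cos_ge0_pihalf.
transitivity (\int[mu]_(x in `[F (- (pi / 2))%R, F (pi / 2)%R]) (G x)%:E)%E.
  rewrite Fa Fb integral_mkcond; apply: eq_integral => x _; rewrite patchE /=.
  rewrite xsection_disk ?ltW// mem_setE; case: ifPn => // _; last by rewrite measure0.
  rewrite lebesgue_measure_itv/= lte_fin /G; set s := Num.sqrt _.
  have s0 : 0 <= s by exact: sqrtr_ge0.
  case: ifPn => [_|]; first by rewrite -EFinB; congr (_%:E); ring.
  by rewrite -leNgt => h; congr (_%:E); lra.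
rewrite integration_by_substitution_increasing.
- rewrite F'E.
  under eq_integral.
    move=> x; rewrite inE/= in_itv/= => xpi.
    rewrite [X in X%:E](GFE _ xpi).
    over.
  pose H : R -> R := fun x => r ^+ 2 * (x + sin x * cos x).
  have dH (x : R) : is_derive x (1 : R) H (2 * r ^+ 2 * cos x ^+ 2).
    apply: (is_derive_eq (is_deriveZ _ (is_deriveD (is_derive_id _ _)
      (is_deriveM (is_derive_sin x) (is_derive_cos x))))).
    rewrite /GRing.scale/=; transitivity (r ^+ 2 * (1 - sin x ^+ 2 + cos x ^+ 2)); first by ring.
    by rewrite sin2cos2; ring.
  have cH' : continuous (fun x : R => 2 * r ^+ 2 * cos x ^+ 2).
    move=> x; apply: cvgM; first exact: cvg_cst.
    apply: (@cvg_comp _ _ _ cos (fun y : R => y ^+ 2)); last exact: exprn_continuous.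
    exact: continuous_cos.
  rewrite (@continuous_FTC2 _ (fun x => 2 * r ^+ 2 * cos x ^+ 2) H).
  + rewrite -EFinB /H sinN cosN cos_pihalf !mulr0; congr (_%:E).
    by field.
  + lra.
  + exact: continuous_subspaceT.
  + apply: LR => x; last by apply: ex_derive.
    by apply/differentiable_continuous/derivable1_diffP; apply: ex_derive.
  + by move=> x _; rewrite derive1E; apply: derive_val.
- lra.
- move=> x y; rewrite !in_itv/= => xpi ypi xy; rewrite /F ltr_pM2l// ltr_sin// in_itv.
- by move=> x _; rewrite F'E; exact: cF'.
- by rewrite F'E; apply/cvg_ex; exists (r * cos (- (pi/2))); apply: cvg_at_right_filter; exact: cF'.
- by rewrite F'E; apply/cvg_ex; exists (r * cos (pi/2)); apply: cvg_at_left_filter; exact: cF'.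
- by apply: LR => // x; apply: ex_derive.
- exact: continuous_subspaceT.
Qed.

(** * Reduction of binary quadratic forms *)

(** When [A], [B], [C] are the Gram coefficients of vectors a, b, this is the squared length of i a
    + j b, and [bform] is the inner product of i a + j b and k a + l b. *)
Definition qform (A B C : R) (i j : int) : R :=
  A * i%:~R ^+ 2 + 2 * B * i%:~R * j%:~R + C * j%:~R ^+ 2.

Definition bform (A B C : R) (i j k l : int) : R :=
  A * i%:~R * k%:~R + B * (i%:~R * l%:~R + j%:~R * k%:~R) + C * j%:~R * l%:~R.

Lemma int_sqr_bound (K : nat) (i : int) : (i%:~R : R) ^+ 2 <= K%:R -> (absz i <= K)%N.
Proof.
rewrite -rmorphXn/= pmulrn ler_int => h; nia.
Qed.

(** The sublevel set of [S] lies in a finite box and is inhabited, so a minimum over the box is a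
    global one. *)
Lemma exists_int_argmin (K : nat) (P : int -> int -> int -> int -> bool)
    (F : int -> int -> int -> int -> R) (S : R) :
  (forall i j k l, P i j k l -> F i j k l <= S ->
    [/\ (absz i <= K)%N, (absz j <= K)%N, (absz k <= K)%N & (absz l <= K)%N]) ->
  (exists i j k l, P i j k l && (F i j k l <= S)) ->
  exists i j k l, P i j k l /\ forall i' j' k' l', P i' j' k' l' -> F i j k l <= F i' j' k' l'.
Proof.
move=> box [i0 [j0 [k0 [l0 /andP[P0 F0]]]]].
pose T := ('I_K.*2.+1 * 'I_K.*2.+1 * ('I_K.*2.+1 * 'I_K.*2.+1))%type.
(* [e] shifts the ordinals 0, ..., 2K onto the integers from -K to K. *)
pose e (x : 'I_K.*2.+1) : int := x%:Z - K%:Z.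
have eK (i : int) : (absz i <= K)%N -> exists x, e x = i.
  move=> iK; have h : (absz (i + Posz K)%R < K.*2.+1)%N by lia.
  exists (Ordinal h); rewrite /e/=; lia.
pose P' (t : T) := P (e t.1.1) (e t.1.2) (e t.2.1) (e t.2.2).
pose F' (t : T) := F (e t.1.1) (e t.1.2) (e t.2.1) (e t.2.2).
have lift i j k l : P i j k l -> F i j k l <= S -> exists t, P' t /\ F' t = F i j k l.
  move=> Pi Fi; have [/eK[x xi] /eK[y yj] /eK[z zk] /eK[w wl]] := box _ _ _ _ Pi Fi.
  by exists (x, y, (z, w)); rewrite /P' /F'/= xi yj zk wl.
have [t0 [Pt0 Ft0]] := lift _ _ _ _ P0 F0.
have [t Pt tmin] := @arg_minP _ _ _ t0 P' F' Pt0.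
exists (e t.1.1), (e t.1.2), (e t.2.1), (e t.2.2); split => // i j k l Pi.
have [Fi|Fi] := leP (F i j k l) S.
  by have [t' [Pt' <-]] := lift _ _ _ _ Pi Fi; exact: tmin.
apply: le_trans (ltW Fi); apply: le_trans F0; rewrite -Ft0; exact: tmin.
Qed.

(* Among the bases, one minimizing the sum of the two diagonal coefficients is
   reduced: replacing a vector by its sum or difference with the other cannot
   decrease it. *)
Lemma form_reduction (A B C : R) : 0 < A -> 0 < A * C - B ^+ 2 ->
  exists i j k l : int, (i * l - j * k) ^+ 2 = 1 /\
    [/\ 0 <= bform A B C i j k l, bform A B C i j k l <= qform A B C i j
      & bform A B C i j k l <= qform A B C k l].
Proof.
move=> A0 D0.
have C0 : 0 < C by nra.
pose S := A + C.
(* [S] is the diagonal sum for the standard basis. Completing the square gives (A C - B^2) j^2 <= A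
   q(i, j) <= S^2 whenever q(i, j) <= S, and likewise for i. *)
pose K := Num.bound (S ^+ 2 / (A * C - B ^+ 2)).
have KE : S ^+ 2 <= K%:R * (A * C - B ^+ 2).
  rewrite -ler_pdivrMr//; apply/ltW/archi_boundP.
  by rewrite divr_ge0 ?sqr_ge0// ltW.
have q0 i j : 0 <= qform A B C i j.
  suff : 0 <= A * qform A B C i j by rewrite pmulr_rge0.
  rewrite (_ : A * _ = (A * i%:~R + B * j%:~R) ^+ 2 + (A * C - B ^+ 2) * j%:~R ^+ 2);
    last by rewrite /qform; ring.
  by rewrite addr_ge0 ?sqr_ge0// mulr_ge0 ?sqr_ge0// ltW.
have qb i j : qform A B C i j <= S -> (absz i <= K)%N /\ (absz j <= K)%N.
  move=> qS; split; apply: int_sqr_bound; rewrite -(ler_pM2r D0).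
    have : C * qform A B C i j = (C * j%:~R + B * i%:~R) ^+ 2 +
        (A * C - B ^+ 2) * i%:~R ^+ 2 by rewrite /qform; ring.
    move: KE qS (q0 i j) (sqr_ge0 (C * j%:~R + B * i%:~R)); rewrite /S.
  move: (qform _ _ _ _ _) => q.
    nra.
  have : A * qform A B C i j = (A * i%:~R + B * j%:~R) ^+ 2 +
      (A * C - B ^+ 2) * j%:~R ^+ 2 by rewrite /qform; ring.
  move: KE qS (q0 i j) (sqr_ge0 (A * i%:~R + B * j%:~R)); rewrite /S.
  move: (qform _ _ _ _ _) => q.
  nra.
have [||i [j [k [l [/eqP ijkl min]]]]]
  := @exists_int_argmin K (fun i j k l => (i * l - j * k) ^+ 2 == 1)
  (fun i j k l => qform A B C i j + qform A B C k l) S.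
- move=> i j k l _ qS; have := q0 i j; have := q0 k l => q1 q2.
  by have [] := @qb i j ltac:(lra); have [] := @qb k l ltac:(lra).
- by exists 1, 0, 0, 1; rewrite /= /qform /S; lra.
have qD i1 j1 k1 l1 : qform A B C (i1 + k1) (j1 + l1) =
    qform A B C i1 j1 + qform A B C k1 l1 + 2 * bform A B C i1 j1 k1 l1.
  by rewrite /qform /bform !intrD; ring.
have qB i1 j1 k1 l1 : qform A B C (i1 - k1) (j1 - l1) =
    qform A B C i1 j1 + qform A B C k1 l1 - 2 * bform A B C i1 j1 k1 l1.
  by rewrite /qform /bform !intrB; ring.
have qC : bform A B C k l i j = bform A B C i j k l by rewrite /bform; ring.
have {}min i' j' k' l' : i' * l' - j' * k' = i * l - j * k ->
    qform A B C i j + qform A B C k l <= qform A B C i' j' + qform A B C k' l'.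
  by move=> E; apply: min; rewrite E ijkl.
(* The four moves preserve the determinant; minimality yields 2 |b| <= q for both basis vectors, b
   being their inner product. *)
have := min i j (k + i) (l + j) ltac:(ring); rewrite qD qC => h1.
have := min i j (k - i) (l - j) ltac:(ring); rewrite qB qC => h2.
have := min (i + k) (j + l) k l ltac:(ring); rewrite qD => h3.
have := min (i - k) (j - l) k l ltac:(ring); rewrite qB => h4.
have [b0|b0] := leP 0 (bform A B C i j k l).
  by exists i, j, k, l; split => //; split => //; lra.
(* Negating the second vector makes b positive and only changes the sign of the determinant. *)
exists i, j, (- k), (- l); split; first by rewrite !mulrN -opprD sqrrN.
have -> : bform A B C i j (- k) (- l) = - bform A B C i j k l by rewrite /bform !intrN; ring.
have -> : qform A B C (- k) (- l) = qform A B C k l by rewrite /qform !intrN; ring.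
by split; lra.
Qed.

(** * Lattice coverings of the plane by disks *)

Definition lattice_disks_cover (a1 a2 b1 b2 r : R) := forall x y : R, exists m n : int,
  (x - (m%:~R * a1 + n%:~R * b1)) ^+ 2 + (y - (m%:~R * a2 + n%:~R * b2)) ^+ 2 <= r ^+ 2.

Lemma int_sqr_subr_ge0 (k : int) : 0 <= (k%:~R : R) ^+ 2 - k%:~R.
Proof. by rewrite -rmorphXn -rmorphB ler0z; nia. Qed.

(* A, B, C are the Gram coefficients of the basis; the circumradius of the
   triangle 0, a, b has square A C (A + C - 2 B) / (4 d^2).  A lattice
   point m a + n b closer to the circumcentre would satisfy
   (A - B) (m^2 - m) + (C - B) (n^2 - n) + B ((m + n)^2 - (m + n)) < 0. *)
Lemma cover_ge_circumradius (a1 a2 b1 b2 r : R) :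
  let A := a1 ^+ 2 + a2 ^+ 2 in let B := a1 * b1 + a2 * b2 in
  let C := b1 ^+ 2 + b2 ^+ 2 in let d := a1 * b2 - a2 * b1 in
  d != 0 -> 0 <= B -> B <= A -> B <= C -> lattice_disks_cover a1 a2 b1 b2 r ->
  A * C * (A + C - 2 * B) <= 4 * d ^+ 2 * r ^+ 2.
Proof.
move=> A B C d d0 B0 BA BC cov.
(* The covering is tested at the circumcentre of 0, a, b. *)
have [m [n]] := cov ((A * b2 - C * a2) / (2 * d)) ((a1 * C - b1 * A) / (2 * d)).
set M : R := m%:~R; set N : R := n%:~R.
set L := (_ + _ in X in X <= _).
have -> : L = A * C * (A + C - 2 * B) / (4 * d ^+ 2) +
  ((A - B) * (M ^+ 2 - M) + (C - B) * (N ^+ 2 - N) + B * ((M + N) ^+ 2 - (M + N))).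
  by rewrite /L /A /B /C /d; field.
have h1 : 0 <= M ^+ 2 - M by exact: int_sqr_subr_ge0.
have h2 : 0 <= N ^+ 2 - N by exact: int_sqr_subr_ge0.
have h3 : 0 <= (M + N) ^+ 2 - (M + N) by rewrite -intrD; exact: int_sqr_subr_ge0.
have : 0 <= (A - B) * (M ^+ 2 - M) + (C - B) * (N ^+ 2 - N) + B * ((M + N) ^+ 2 - (M + N)).
  by rewrite !addr_ge0// mulr_ge0// subr_ge0.
move=> h4 h5.
rewrite [X in _ <= X]mulrC -ler_pdivrMr; first lra.
by rewrite mulr_gt0// exprn_even_gt0.
Qed.

(* The average of the squared distances from x to the vertices, weighted by the
   barycentric coordinates of x, is R^2 - |x - c|^2, c being the circumcentre. *)
Lemma cover_of_circumradius (a1 a2 b1 b2 r : R) :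
  let A := a1 ^+ 2 + a2 ^+ 2 in let B := a1 * b1 + a2 * b2 in
  let C := b1 ^+ 2 + b2 ^+ 2 in let d := a1 * b2 - a2 * b1 in
  d != 0 -> A * C * (A + C - 2 * B) <= 4 * d ^+ 2 * r ^+ 2 ->
  lattice_disks_cover a1 a2 b1 b2 r.
Proof.
move=> A B C d d0 hr.
have d2 : 0 < 4 * d ^+ 2 by rewrite mulr_gt0// exprn_even_gt0.
pose Q (s u : R) := (s * a1 + u * b1) ^+ 2 + (s * a2 + u * b2) ^+ 2.
(* For the point s a + u b of the triangle, the three values of [Q] are its squared distances to 0,
   a and b. *)
have tri s u : 0 <= s -> 0 <= u -> s + u <= 1 ->
    [\/ Q s u <= r ^+ 2, Q (s - 1) u <= r ^+ 2 | Q s (u - 1) <= r ^+ 2].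
  move=> s0 u0 su1.
  have [h1|h1] := leP (Q s u) (r ^+ 2); first by constructor 1.
  have [h2|h2] := leP (Q (s - 1) u) (r ^+ 2); first by constructor 2.
  have [h3|h3] := leP (Q s (u - 1)) (r ^+ 2); first by constructor 3.
  have : (1 - s - u) * Q s u + s * Q (s - 1) u + u * Q s (u - 1) <= r ^+ 2.
    rewrite -(ler_pM2l d2); apply: le_trans hr.
    rewrite -subr_ge0.
    have -> : A * C * (A + C - 2 * B) - 4 * d ^+ 2 *
        ((1 - s - u) * Q s u + s * Q (s - 1) u + u * Q s (u - 1)) =
      (2 * d * (s * a1 + u * b1) - (A * b2 - C * a2)) ^+ 2 +
      (2 * d * (s * a2 + u * b2) - (a1 * C - b1 * A)) ^+ 2.
      by rewrite /Q /A /B /C /d; ring.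
    by rewrite addr_ge0 ?sqr_ge0.
  (* Some barycentric weight is positive, so three distances above r would push the weighted average
     above r^2. *)
  have [w0|w0] : 0 < 1 - s - u \/ 1 - s - u = 0 by lra.
    by nra.
  have [s1|s1] : 0 < s \/ s = 0 by lra.
    nra.
  nra.
move=> x y.
pose s := (x * b2 - y * b1) / d; pose u := (a1 * y - a2 * x) / d.
pose m := Num.floor s; pose n := Num.floor u.
have /andP[ms ms1] := floor_itv s; have /andP[nu nu1] := floor_itv u.
rewrite intrD in ms1; rewrite intrD in nu1.
have E (i j : int) : (x - (i%:~R * a1 + j%:~R * b1)) ^+ 2 + (y - (i%:~R * a2 + j%:~R * b2)) ^+ 2 =
    Q (s - i%:~R) (u - j%:~R).
  have -> : x = s * a1 + u * b1 by rewrite /s /u /d; field.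
  have -> : y = s * a2 + u * b2 by rewrite /s /u /d; field.
  by rewrite /Q; ring.
(* The floors bring the point into the fundamental parallelogram, cut here along the diagonal from a
   to b. The point reflection (s, u) -> (1 - s, 1 - u) takes the far half to the triangle 0, a,
   b. *)
have [su|su] := leP ((s - m%:~R) + (u - n%:~R)) 1.
  have [||//|h|h|h] := tri (s - m%:~R) (u - n%:~R); [lra|lra| | |].
  - by exists m, n; rewrite E.
  - by exists (m + 1), n; rewrite E intrD opprD addrA.
  - by exists m, (n + 1); rewrite E intrD opprD addrA.
have QN s' u' : Q (- s') (- u') = Q s' u' by rewrite /Q; ring.
have [|||h|h|h] := tri (1 - (s - m%:~R)) (1 - (u - n%:~R)); [lra|lra|lra| | |].
- exists (m + 1), (n + 1); rewrite E !intrD -QN; move: h; congr (Q _ _ <= _); ring.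
- exists m, (n + 1); rewrite E !intrD -QN; move: h; congr (Q _ _ <= _); ring.
- exists (m + 1), n; rewrite E !intrD -QN; move: h; congr (Q _ _ <= _); ring.
Qed.

(* With p = A - B, q = C - B, s = B this bounds the area of a non-obtuse triangle
   by that of the equilateral triangle with the same circumradius. *)
Lemma triangle_form_ineq (p q s : R) : 0 <= p -> 0 <= q -> 0 <= s ->
  64 * (p * q + q * s + s * p) ^+ 3 <= 27 * ((p + q) * (q + s) * (s + p)) ^+ 2.
Proof.
move=> p0 q0 s0; set E := p * q + _ + _; set P := (p + q) * _ * _; pose S := p + q + s.
have E0 : 0 <= E by rewrite /E; nra.
have h1 : 8 * (S * E) <= 9 * P.
  rewrite -subr_ge0 (_ : _ - _ = p * (q - s) ^+ 2 + q * (s - p) ^+ 2 + s * (p - q) ^+ 2); last first.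
    by rewrite /S /E /P; ring.
  by rewrite !addr_ge0// mulr_ge0// sqr_ge0.
have h2 : 3 * E <= S ^+ 2.
  rewrite -subr_ge0 (_ : _ - _ = ((p - q) ^+ 2 + (q - s) ^+ 2 + (s - p) ^+ 2) / 2); last first.
    by rewrite /S /E; field.
  by rewrite divr_ge0// !addr_ge0// sqr_ge0.
have SE : 0 <= S * E by rewrite mulr_ge0// /S !addr_ge0.
have h3 : (8 * (S * E)) ^+ 2 <= (9 * P) ^+ 2 by rewrite lerXn2r// nnegrE; lra.
have h4 : E ^+ 2 * (3 * E) <= E ^+ 2 * S ^+ 2 by rewrite ler_wpM2l// sqr_ge0.
rewrite !exprMn in h3.
(* The bounds chain as 192 E^3 <= 64 E^2 S^2 <= 81 P^2. *)
clearbody S E P; nra.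
Qed.

(** With E = d^2 and P = A C (A + C - 2 B), the triangle inequality 64 E^3 <= 27 P^2 and the
    circumradius bound P <= 4 E r^2 leave 4 E <= 27 r^4. *)
Lemma nonobtuse_cover_bound (a1 a2 b1 b2 r : R) :
  let A := a1 ^+ 2 + a2 ^+ 2 in let B := a1 * b1 + a2 * b2 in
  let C := b1 ^+ 2 + b2 ^+ 2 in let d := a1 * b2 - a2 * b1 in
  d != 0 -> 0 <= B -> B <= A -> B <= C -> lattice_disks_cover a1 a2 b1 b2 r ->
  4 * d ^+ 2 <= 27 * (r ^+ 2) ^+ 2.
Proof.
move=> A B C d d0 B0 BA BC cov.
have := cover_ge_circumradius _ _ _ _ _ d0 B0 BA BC cov; rewrite -/A -/B -/C -/d => h.
have := triangle_form_ineq (A - B) (C - B) B ltac:(lra) ltac:(lra) B0.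
have -> : (A - B) * (C - B) + (C - B) * B + B * (A - B) = d ^+ 2 by rewrite /A /B /C /d; ring.
have -> : (A - B + (C - B)) * (C - B + B) * (B + (A - B)) = A * C * (A + C - 2 * B) by ring.
set P := A * C * _ in h *; set E := d ^+ 2 in h * => h2.
have E0 : 0 < E by rewrite exprn_even_gt0.
have P0 : 0 <= P by rewrite /P !mulr_ge0//; lra.
have h3 : P ^+ 2 <= (4 * E * r ^+ 2) ^+ 2 by rewrite lerXn2r// nnegrE//; lra.
rewrite -(ler_pM2l (_ : 0 < 16 * E ^+ 2)); last by rewrite mulr_gt0// exprn_gt0.
have -> : 16 * E ^+ 2 * (4 * E) = 64 * E ^+ 3 by ring.
clearbody E P; nra.
Qed.

(** * Densities of cylinder coverings *)

Lemma Vol_prism (A : set (R * R)) (h : R) : measurable A -> 0 <= h ->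
  Vol [set p : sol R | A p.1 /\ 0 <= p.2 <= h] = ((mu \x mu)%E A * h%:E)%E.
Proof.
move=> mA h0; rewrite /Vol.
rewrite (_ : mkset _ = A `*` `[0, h]); last first.
  by apply/seteqP; split => -[x y]; rewrite /= in_itv.
transitivity ((mu \x mu)%E A * mu `[0%R, h]%classic)%E; first exact: product_measure1E.
rewrite lebesgue_measure_itv/= lte_fin oppr0 adde0.
by congr (_ * _)%E; case: ltP => // h0'; congr (_%:E); lra.
Qed.

Lemma lat_h_gt0 (N : int) : 3 <= N -> 0 < lat_h N :> R.
Proof.
move=> N3; apply: ln_gt0.
have N3' : 3 <= N%:~R :> R by rewrite (_ : 3 = 3%:~R)// ler_int.
by have := sqrtr_ge0 (N%:~R ^+ 2 - 4 : R); lra.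
Qed.

Lemma expR_lat_h_diff_gt0 (N : int) : 3 <= N ->
  0 < expR (lat_h N) - expR (- lat_h N) :> R.
Proof. by move=> /lat_h_gt0 h; rewrite subr_gt0 ltr_expR; lra. Qed.

Lemma densityE (t1 t2 r : R) (N : int) : t1 != 0 -> t2 != 0 -> 3 <= N -> 0 < r ->
  density t1 t2 N r = pi * r ^+ 2 / `|t1 * t2 * (expR (lat_h N) - expR (- lat_h N))|.
Proof.
move=> t10 t20 N3 r0; have h0 := lat_h_gt0 _ N3; have d0 := expR_lat_h_diff_gt0 _ N3.
rewrite /density (_ : bounded_cylinder _ _ = [set p : sol R | disk r p.1 /\ 0 <= p.2 <= lat_h N])//.
rewrite Vol_prism ?ltW//; last exact: measurable_disk.
rewrite area_disk//.
set h := lat_h N in h0 d0 *.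
have detE : t1 * (t2 * expR h) - t2 * (t1 * expR (- h)) = t1 * t2 * (expR h - expR (- h)) by ring.
have det0 : t1 * t2 * (expR h - expR (- h)) != 0.
  by rewrite !mulf_neq0// gt_eqF.
pose A := parallelogram t1 t2 (t1 * expR (- h)) (t2 * expR h).
rewrite (_ : parallelepiped _ _ _ = [set p : sol R | A p.1 /\ 0 <= p.2 <= h]); last first.
  apply/seteqP; split => -[p z]/=.
    by move=> [s [u [s01 u01 z0 pE]]]; split => //; exists s, u.
  by move=> [[s [u [s01 u01 pE]]] z0]; exists s, u.
rewrite Vol_prism ?ltW//; last first.
  by apply: measurable_parallelogram; rewrite detE.
rewrite area_parallelogram ?detE// -!EFinM /=.
by rewrite -mulf_div divff ?mulr1// gt_eqF.
Qed.

(** Right multiplication by a point of the base plane is a Euclidean translation, since the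
    exponentials are taken at 0; the height z is then free. *)
Lemma admissibleP (t1 t2 r : R) (N : int) :
  admissible t1 t2 N r <->
  0 < r /\ lattice_disks_cover t1 t2 (t1 * expR (- lat_h N)) (t2 * expR (lat_h N)) r.
Proof.
rewrite /admissible /lattice_disks_cover; split => -[r0 cov]; split => //.
  move=> x y; have : [set: sol R] (x, y, 0) by [].
  rewrite -cov => -[_ [m [n ->]] [[[a b] c] abc]].
  rewrite [X in X = _](_ : _ = (m%:~R * t1 + n%:~R * (t1 * expR (- lat_h N)) + a,
    m%:~R * t2 + n%:~R * (t2 * expR (lat_h N)) + b, c)); last first.
    by rewrite [LHS]/(sol_mul _ _)/= oppr0 expR0 !mulr1 add0r.
  move=> [<- <- _]; exists m, n; move: abc; rewrite /cylinder/=; congr (_ + _ <= _); ring.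
apply/seteqP; split => // -[[x y] z] _; have [m [n mn]] := cov x y.
exists (m%:~R * t1 + n%:~R * (t1 * expR (- lat_h N)),
  m%:~R * t2 + n%:~R * (t2 * expR (lat_h N)), 0).
  by exists m, n.
exists (x - (m%:~R * t1 + n%:~R * (t1 * expR (- lat_h N))),
  y - (m%:~R * t2 + n%:~R * (t2 * expR (lat_h N))), z) => //.
rewrite [LHS]/(sol_mul _ _)/= oppr0 expR0 !mulr1 add0r.
by congr (_, _, _); ring.
Qed.

(** A reduced basis spans the same lattice, and its determinant differs from d by the sign [e], so
    the non-obtuse case applies. *)
Lemma lattice_cover_det_bound (a1 a2 b1 b2 r : R) : a1 * b2 - a2 * b1 != 0 ->
  lattice_disks_cover a1 a2 b1 b2 r ->
  4 * (a1 * b2 - a2 * b1) ^+ 2 <= 27 * (r ^+ 2) ^+ 2.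
Proof.
set d := _ - _ => d0 cov.
pose A := a1 ^+ 2 + a2 ^+ 2; pose B := a1 * b1 + a2 * b2; pose C := b1 ^+ 2 + b2 ^+ 2.
have A0 : 0 < A.
  rewrite lt_neqAle eq_sym addr_ge0 ?sqr_ge0// andbT; apply: contraNneq d0 => /eqP.
  rewrite paddr_eq0 ?sqr_ge0// !sqrf_eq0 => /andP[/eqP a10 /eqP a20].
  by rewrite /d a10 a20 !mul0r subrr.
have D0 : 0 < A * C - B ^+ 2.
  by rewrite (_ : _ - _ = d ^+ 2) ?exprn_even_gt0// /A /B /C /d; ring.
have [i [j [k [l [ijkl [h1 h2 h3]]]]]] := form_reduction _ _ _ A0 D0.
set e := i * l - j * k in ijkl.
have eR : (e%:~R : R) ^+ 2 = 1 by rewrite -rmorphXn/= ijkl.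
have eE : e%:~R = i%:~R * l%:~R - j%:~R * k%:~R :> R by rewrite intrB !intrM.
clearbody e.
have dE : (i%:~R * a1 + j%:~R * b1) * (k%:~R * a2 + l%:~R * b2) -
    (i%:~R * a2 + j%:~R * b2) * (k%:~R * a1 + l%:~R * b1) = e%:~R * d.
  by rewrite eE /d; ring.
have := nonobtuse_cover_bound (i%:~R * a1 + j%:~R * b1) (i%:~R * a2 + j%:~R * b2)
  (k%:~R * a1 + l%:~R * b1) (k%:~R * a2 + l%:~R * b2) r.
have -> : d ^+ 2 = (e%:~R * d) ^+ 2 by rewrite exprMn eR mul1r.
rewrite dE; apply.
- by rewrite mulf_neq0//; rewrite -sqrf_eq0 eR oner_eq0.
- by move: h1; congr (_ <= _); rewrite /bform /A /B /C; ring.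
- by move: h2; congr (_ <= _); rewrite /bform /qform /A /B /C; ring.
- by move: h3; congr (_ <= _); rewrite /bform /qform /A /B /C; ring.
move=> x y; have [m [n mn]] := cov x y.
(* Coordinates in the new basis: as e^2 = 1, the inverse of the base change is [e] times its
   adjugate. *)
exists (e * (m * l - n * k)), (e * (n * i - m * j)).
have eM : m%:~R = e%:~R ^+ 2 * m%:~R :> R by rewrite eR mul1r.
have eN : n%:~R = e%:~R ^+ 2 * n%:~R :> R by rewrite eR mul1r.
by move: mn; rewrite eM eN; congr (_ ^+ 2 + _ ^+ 2 <= _); rewrite !intrM !intrB !intrM eE; ring.
Qed.

Lemma density_lower_bound (t1 t2 : R) (N : int) (x : R) : t1 != 0 -> t2 != 0 -> 3 <= N ->
  densities t1 t2 N x -> 2 * pi / Num.sqrt 27 <= x.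
Proof.
move=> t10 t20 N3 [r /admissibleP[r0 cov] <-]; rewrite densityE//.
have d0 := expR_lat_h_diff_gt0 _ N3; set h := lat_h N in cov d0 *.
have detE : t1 * (t2 * expR h) - t2 * (t1 * expR (- h)) = t1 * t2 * (expR h - expR (- h)) by ring.
have det0 : t1 * t2 * (expR h - expR (- h)) != 0.
  by rewrite !mulf_neq0// gt_eqF.
have hd := lattice_cover_det_bound _ _ _ _ _
  (etrans (congr1 (fun z => z != 0) detE) det0) cov.
rewrite detE in hd.
set d := t1 * t2 * _ in det0 hd *.
have nd : 0 < `|d| by rewrite normr_gt0.
have s27 : 0 < Num.sqrt 27 :> R by rewrite sqrtr_gt0.
rewrite ler_pdivlMr// mulrAC ler_pdivrMr// [2 * pi]mulrC -!mulrA ler_pM2l ?pi_gt0//.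
rewrite -(ler_pXn2r (_ : 0 < 2)%N)// ?nnegrE ?mulr_ge0 ?sqr_ge0 ?sqrtr_ge0 ?(ltW r0)//.
by rewrite !exprMn sqr_sqrtr// real_normK ?num_real//; lra.
Qed.

(** The density increases with r, so the least admissible radius attains the infimum. *)
Lemma Delta_min (t1 t2 : R) (N : int) (rho : R) : t1 != 0 -> t2 != 0 -> 3 <= N ->
  0 < rho -> (forall r, 0 < r -> admissible t1 t2 N r <-> rho <= r) ->
  densities t1 t2 N (Delta t1 t2 N) /\
  Delta t1 t2 N = pi * rho ^+ 2 / `|t1 * t2 * (expR (lat_h N) - expR (- lat_h N))|.
Proof.
move=> t10 t20 N3 rho0 adm.
have arho : admissible t1 t2 N rho by apply/adm.
have drho : densities t1 t2 N (density t1 t2 N rho) by exists rho.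
have lb : lbound (densities t1 t2 N) (density t1 t2 N rho).
  move=> _ [r ar <-]; have r0 := ar.1; have rr := (adm r r0).1 ar.
  rewrite !densityE// ler_wpM2r ?invr_ge0// ler_wpM2l ?pi_ge0// lerXn2r// nnegrE ltW//.
have DE : Delta t1 t2 N = density t1 t2 N rho.
  apply/eqP; rewrite eq_le; apply/andP; split.
    by apply: ge_inf => //; exists (density t1 t2 N rho).
  by apply: lb_le_inf => //; exists (density t1 t2 N rho).
by rewrite DE; split => //; rewrite densityE.
Qed.

Lemma sqrt_bounds (a b x : R) : 0 <= a -> 0 <= b -> a ^+ 2 <= x -> x <= b ^+ 2 ->
  a <= Num.sqrt x <= b.
Proof.
move=> a0 b0 ax xb; apply/andP; split.
  by rewrite -[a]ger0_norm// -sqrtr_sqr ler_wsqrtr.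
by rewrite -[b]ger0_norm// -sqrtr_sqr ler_wsqrtr.
Qed.

Lemma hexagonal_density_approx :
  `|2 * pi / Num.sqrt 27 - (1 + 209 / 10 ^+ 3 + 20 / 10 ^+ 5) : R| <= 5 / 10 ^+ 6.
Proof.
have /andP[p1 p2] := pi_bounds.
have qb : 5 + 1961 / 10 ^+ 4 + 5 / 10 ^+ 5 <= Num.sqrt (27 : R)
    <= 5 + 1961 / 10 ^+ 4 + 6 / 10 ^+ 5 by apply: sqrt_bounds; lra.
case/andP: qb; move: (Num.sqrt _) => q q1 q2; have q0 : 0 < q by lra.
rewrite ler_norml lerBrDr lerBlDr ler_pdivlMr// ler_pdivrMr//; apply/andP; split; lra.
Qed.

(** * The lattice (1, (3 - sqrt 5) / 2, 3) *)

Let s : R := Num.sqrt 5.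

Lemma sqr_sqrt5 : s ^+ 2 = 5. Proof. by rewrite sqr_sqrtr. Qed.

(** The lower end needs its seven decimals: times 9/50 and 3.14159 it exceeds 1.264465 by less than
    10^-6. *)
Lemma sqrt5_bounds :
  2 + 236 / 10 ^+ 3 + 67 / 10 ^+ 6 + 9 / 10 ^+ 7 <= s <= 2 + 236 / 10 ^+ 3 + 68 / 10 ^+ 6.
Proof. by apply: sqrt_bounds; lra. Qed.

(** Modulo s^2 = 5 both (s - 3)^3 and (2 s - 5)^2 are multiples of 4 s - 9, which cancels. *)
Lemma golden_density_eq :
  - (36 / 125) * (((2 * s - 5) ^+ 2 * pi * s) / (s - 3) ^+ 3) = 9 / 50 * pi * s.
Proof.
have /andP[s1 s2] := sqrt5_bounds; have s5 := sqr_sqrt5.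
have -> : (s - 3) ^+ 3 = 8 * (4 * s - 9).
  transitivity (s * s ^+ 2 - 9 * s ^+ 2 + 27 * s - 27); first by ring.
  by rewrite s5; ring.
have -> : (2 * s - 5) ^+ 2 = - 5 * (4 * s - 9).
  transitivity (4 * s ^+ 2 - 20 * s + 25); first by ring.
  by rewrite s5; ring.
have : 4 * s - 9 != 0 by rewrite lt_eqF//; lra.
by move=> h; field.
Qed.

Lemma golden_density_approx :
  `|9 / 50 * pi * s - (1 + 264 / 10 ^+ 3 + 47 / 10 ^+ 5)| <= 5 / 10 ^+ 6.
Proof.
have /andP[p1 p2] := pi_bounds; have /andP[s1 s2] := sqrt5_bounds.
rewrite ler_norml; apply/andP; split; nra.
Qed.

Lemma expR_lat_h3 : expR (lat_h 3) = (3 + s) / 2 /\ expR (- lat_h 3) = (3 - s) / 2.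
Proof.
have /andP[s1 s2] := sqrt5_bounds; have s5 := sqr_sqrt5.
have e1 : expR (lat_h 3) = (3 + s) / 2.
  rewrite /lat_h (_ : (3%:~R : R) ^+ 2 - 4 = 5); last by ring.
  by rewrite -/s lnK// posrE; lra.
split=> //; rewrite expRN e1 invf_div; apply/eqP; rewrite eqr_div; last 2 first.
- by rewrite gt_eqF//; lra.
- by [].
by apply/eqP; transitivity (9 - s ^+ 2); [rewrite s5|]; ring.
Qed.

(* The radicand is the squared circumradius of the triangle 0, (1, t), (t, 1)
   with t = (3 - s) / 2. *)
Lemma golden_lattice_cover (r : R) : 0 < r ->
  admissible 1 ((3 - s) / 2) 3 r <->
  Num.sqrt ((162 - 72 * s) / (3 * s - 5) ^+ 2) <= r.
Proof.
have /andP[s1 s2] := sqrt5_bounds; have s5 := sqr_sqrt5.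
move=> r0; set t := (3 - s) / 2.
have [e1 e2] := expR_lat_h3.
(* [t] is the inverse of exp h, so [tau2] is (t, 1). *)
have b2 : t * ((3 + s) / 2) = 1.
  transitivity ((9 - s ^+ 2) / 4); first by rewrite /t; field.
  by rewrite s5; field.
rewrite (_ : Num.sqrt _ <= r <-> (162 - 72 * s) <= (3 * s - 5) ^+ 2 * r ^+ 2); last first.
  have d2 : 0 < (3 * s - 5) ^+ 2 by rewrite exprn_gt0//; lra.
  by rewrite [_ * r ^+ 2]mulrC -ler_pdivrMr// -[X in _ <= X]ger0_norm ?(ltW r0)//
    -sqrtr_sqr ler_sqrt ?sqr_ge0.
rewrite admissibleP e1 e2 !mul1r b2.
(* As a root of X^2 - 3 X + 1, [t] gives Gram coefficients A = C = 3 t and B = 2 t: the triangle is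
   not obtuse and A C (A + C - 2 B) = 18 t^3. *)
have t2 : t ^+ 2 = 3 * t - 1 by rewrite /t; nra.
have tt : t * t = 3 * t - 1 by rewrite -t2 expr2.
have d0 : 1 * 1 - t * t != 0 by rewrite tt gt_eqF// /t; lra.
have dE : 4 * (1 * 1 - t * t) ^+ 2 = (3 * s - 5) ^+ 2.
  by rewrite tt /t; field.
have PE : (1 ^+ 2 + t ^+ 2) * (t ^+ 2 + 1 ^+ 2) *
    (1 ^+ 2 + t ^+ 2 + (t ^+ 2 + 1 ^+ 2) - 2 * (1 * t + t * 1)) = 162 - 72 * s.
  rewrite expr1n t2; transitivity (18 * t ^+ 2 * t); first by ring.
  rewrite t2; transitivity (54 * t ^+ 2 - 18 * t); first by ring.
  by rewrite t2 /t; field.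
split => [[_ cov]|h].
  have := @cover_ge_circumradius 1 t t 1 r d0 _ _ _ cov; rewrite PE dE; apply.
  - by rewrite /t; lra.
  - by rewrite t2 /t; lra.
  - by rewrite t2 /t; lra.
split => //; apply: (@cover_of_circumradius 1 t t 1 r d0).
by rewrite PE dE.
Qed.

Lemma golden_lattice_Delta :
  densities 1 ((3 - s) / 2) 3 (Delta 1 ((3 - s) / 2) 3) /\
  Delta 1 ((3 - s) / 2) 3 = 9 / 50 * pi * s.
Proof.
have /andP[s1 s2] := sqrt5_bounds; have s5 := sqr_sqrt5.
have q0 : 0 < (162 - 72 * s) / (3 * s - 5) ^+ 2.
  by rewrite divr_gt0 ?exprn_gt0//; lra.
have t0 : (3 - s) / 2 != 0 by rewrite gt_eqF//; lra.
have [//||dm DE] := Delta_min 1 _ 3 _ (oner_neq0 _) t0 _ _ golden_lattice_cover.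
  by rewrite sqrtr_gt0.
split=> //; rewrite DE sqr_sqrtr ?ltW// mul1r; have [-> ->] := expR_lat_h3.
have -> : (3 - s) / 2 * ((3 + s) / 2 - (3 - s) / 2) = (3 * s - 5) / 2.
  by transitivity ((3 * s - s ^+ 2) / 2); [field|rewrite s5].
rewrite gtr0_norm; last lra.
have d0 : 3 * s - 5 != 0 by rewrite gt_eqF//; lra.
apply/eqP; rewrite -subr_eq0.
have -> : pi * ((162 - 72 * s) / (3 * s - 5) ^+ 2) / ((3 * s - 5) / 2) - 9 / 50 * pi * s
  = pi * (324 - 144 * s - 9 / 50 * s * (3 * s - 5) ^+ 3) / (3 * s - 5) ^+ 3 by field.
(* The cube is expanded with [s ^+ 2] kept as a factor, so that [s5] can rewrite it. *)
have -> : (3 * s - 5) ^+ 3 = 27 * s ^+ 2 * s - 135 * s ^+ 2 + 225 * s - 125 by ring.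
have -> : 324 - 144 * s - 9 / 50 * s * (27 * s ^+ 2 * s - 135 * s ^+ 2 + 225 * s - 125) = 0.
  rewrite s5; transitivity (324 - 144 * s - 9 / 50 * (360 * s ^+ 2 - 800 * s)); first by field.
  by rewrite s5; field.
by rewrite mulr0 mul0r.
Qed.
End SolCylinderCoverings.

(* The decimals 1.20920 and 1.26447 are written as sums of small fractions
   (numerals are unary); 5 / 10 ^+ 6 is half a unit of the fifth decimal. *)
Theorem theorem4p14 (R : realType) :
  let t2 : R := (3 - Num.sqrt 5) / 2 in
  let v : R := - (36 / 125) * (((2 * Num.sqrt 5 - 5) ^+ 2 * pi * Num.sqrt 5)
                 / (Num.sqrt 5 - 3) ^+ 3) in
  [/\ `|2 * pi / Num.sqrt 27 - (1 + 209 / 10 ^+ 3 + 20 / 10 ^+ 5) : R|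
        <= 5 / 10 ^+ 6,
      2 * pi / Num.sqrt 27 <= Delta_opt R,
      Delta_opt R <= Delta 1 t2 3,
      densities 1 t2 3 (Delta 1 t2 3) /\ Delta 1 t2 3 = v
    & `|v - (1 + 264 / 10 ^+ 3 + 47 / 10 ^+ 5)| <= 5 / 10 ^+ 6].
Proof.
move=> t2 v; have [dmin DE] := golden_lattice_Delta R.
have vE : v = 9 / 50 * pi * Num.sqrt 5 by exact: golden_density_eq.
have t20 : t2 != 0 by have /andP[s1 s2] := sqrt5_bounds R; rewrite /t2 gt_eqF//; lra.
(* Being attained, this minimum is itself one of the densities: it makes the set nonempty and bounds
   its infimum from above. *)
have mem : @all_densities R (Delta 1 t2 3).
  by exists 1, t2, 3; split=> //; exact: oner_neq0.
have lb : lbound (@all_densities R) (2 * pi / Num.sqrt 27).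
  by move=> x [u1 [u2 [N [u10 u20 N3 /density_lower_bound]]]]; apply.
split.
- exact: hexagonal_density_approx.
- by apply: lb_le_inf => //; exists (Delta 1 t2 3).
- by apply: ge_inf => //; exists (2 * pi / Num.sqrt 27).
- by rewrite vE.
- by rewrite vE; exact: golden_density_approx.
Qed.
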